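(* Let $I$ and $I'$ be PESP instances with fractional periodic timetabling polytopes $\mathcal P$ and $\mathcal P'$, respectively. Suppose that $I'$ arises from $I$ by a sequence of simple subdivisions and simple free augmentations. If $\psi:\mathcal P'\to\mathcal P$ denotes the composition of the summation maps $\rho$ for the subdivisions and the natural projection maps $\varphi$ for the free augmentations, then $\psi(\mathcal P'_{\mathrm{split}})=\mathcal P_{\mathrm{split}}$.
   Context: A PESP instance $(G,T,\ell,u,w)$ consists of a finite weakly connected directed graph $G=(V,A)$, a period $T\in\mathbb N$, $T\ge 2$, bounds $\ell,u\in\mathbb Z^A$ and weights $w\in\mathbb R^A$. The cycle space is $\mathcal C=\{\gamma\in\mathbb Z^A \mid \sum_{a\in\delta^+(i)}\gamma_a=\sum_{a\in\delta^-(i)}\gamma_a\ \forall i\in V\}$, of rank $\mu=|A|-|V|+1$. An oriented cycle is an element of $\mathcal C\cap\{-1,0,1\}^A$. An integral cycle basis is a set $B$ of $\mu$ oriented cycles forming a $\mathbb Z$-basis of $\mathcal C$; its cycle matrix $\Gamma\in\{-1,0,1\}^{B\times A}$ has the elements of $B$ as rows. The fractional periodic timetabling polytope is $\mathcal P=\{(x,z)\in\mathbb R^A\times\mathbb R^B\mid \Gamma x=Tz,\ \ell\le x\le u\}$. Its split closure (with $z$ the integer variables) is $\mathcal P_{\mathrm{split}}=\bigcap_{\beta\in\mathbb Z^B}\operatorname{conv}\{(x,z)\in\mathcal P\mid\beta^\top z\in\mathbb Z\}$. Simple subdivision: $I'=(G',T,\ell',u',w')$ is a simple subdivision of $I=(G,T,\ell,u,w)$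 at an arc $\overline a$ with $\ell_{\overline a}<u_{\overline a}$ if it arises by subdividing $\overline a=(i,j)$ into two new arcs $a_1=(i,v)$, $a_2=(v,j)$ ($v$ a new vertex) such that $0\le\ell'_{a_1}\le u'_{a_1}$, $0\le\ell'_{a_2}\le u'_{a_2}$, $\ell'_{a_1}+\ell'_{a_2}=\ell_{\overline a}$, $u'_{a_1}+u'_{a_2}=u_{\overline a}$, $w'_{a_1}=w'_{a_2}=w_{\overline a}$, all other data being unchanged. For $\gamma$ in the cycle space of $G$ define $\gamma'$ in the cycle space of $G'$ by $\gamma'_{a_1}=\gamma'_{a_2}=\gamma_{\overline a}$ and $\gamma'_a=\gamma_a$ otherwise; this is an isomorphism of cycle spaces. If $B$ is the integral cycle basis used for $G$, then $B'=\{\gamma'\mid\gamma\in B\}$ is used for $G'$, and $z'_{\gamma'}$ is identified with $z_\gamma$. The summation map is $\rho:\mathcal P'\to\mathcal P$, $(x,x_{a_1},x_{a_2},z)\mapsto(x,x_{a_1}+x_{a_2},z)$, the entry $x_{a_1}+x_{a_2}$ being the coordinate of $\overline a$. Simple free augmentation: $I'=(G',T,\ell',u',w')$ is a simple free augmentation of $I=(G,T,\ell,u,w)$ by $\overline a$ if $I$ arises from $I'$ by deleting an arc $\overline a$ (together with an end vertex that becomes isolated, if any) which is free, i.e., $u'_{\overline a}-\ell'_{\overline a}=T-1$. If $\overline a$ is a bridge of $G'$, the same integral cycle basis $B$ is used for $G$ and $G'$ and the natural projection is $\varphi:\mathcal P'\to\mathcal P$, $(x,x_{\overline a},z)\mapsto(x,z)$.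 If $\overline a$ is not a bridge, one uses an integral cycle basis $B$ of $G$ and an integral cycle basis $B'=B\cup\{\overline\gamma\}$ of $G'$, where $\overline\gamma$ is an oriented cycle containing $\overline a$ (elements of the cycle space of $G$ being extended by $0$ on $\overline a$), and the natural projection is $\varphi:\mathcal P'\to\mathcal P$, $(x,x_{\overline a},z,z_{\overline\gamma})\mapsto(x,z)$. For a sequence of such operations the cycle bases are transported step by step in this way. *)

(* Defs.v *)
From HB Require Import structures.
From mathcomp Require Import all_boot all_order all_algebra.
From mathcomp Require Import boolp classical_sets reals convex.

Set Implicit Arguments.
Unset Strict Implicit.
Unset Printing Implicit Defensive.

Import Order.TTheory GRing.Theory Num.Theory.

Local Open Scope classical_set_scope.
Local Open Scope ring_scope.

(* Arcs are abstract and carry their end points, so parallel arcs and loops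
   are allowed. *)
Record digraph := Digraph {
  vertex : finType;
  arc : finType;
  tail : arc -> vertex;
  head : arc -> vertex
}.

Definition adjacent (G : digraph) (S : {set arc G}) : rel (vertex G) :=
  fun i j => [exists a in S,
    ((tail a == i) && (head a == j)) || ((tail a == j) && (head a == i))].

(* Weak connectivity of the spanning subgraph (vertex G, S); the graph without
   vertices does not count as connected. *)
Definition weakly_connected (G : digraph) (S : {set arc G}) : bool :=
  (0 < #|vertex G|)%N && [forall i, forall j, connect (adjacent S) i j].

Definition bridge (G : digraph) (a : arc G) : bool :=
  ~~ weakly_connected [set~ a].

Record pesp (R : realType) := Pesp {
  graph :> digraph;
  period : nat;
  lo : arc graph -> int;
  up : arc graph -> int;
  weight : arc graph -> R;
  graph_connected : weakly_connected [set: arc graph];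
  period_ge2 : (2 <= period)%N
}.

Definition cycle_space (G : digraph) : set {ffun arc G -> int} :=
  [set g | forall i : vertex G,
    \sum_(a | tail a == i) g a = \sum_(a | head a == i) g a].

Definition oriented_cycle (G : digraph) : set {ffun arc G -> int} :=
  [set g | cycle_space g /\ forall a, g a \in [:: -1; 0; 1]].

(* An integral cycle basis, presented as the family of rows of its cycle
   matrix.  The indexing is injective because the family is Z-free; the
   cardinality condition is |B| = |A| - |V| + 1. *)
Record cycle_basis (G : digraph) := CycleBasis {
  bidx : finType;
  cycle : bidx -> {ffun arc G -> int};
  cycle_oriented : forall k, oriented_cycle (cycle k);
  cycle_card : (#|bidx| + #|vertex G| = #|arc G| + 1)%N;
  cycle_free : forall c : bidx -> int,
    \sum_k cycle k *~ c k = 0 -> forall k, c k = 0;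
  cycle_span : forall g, cycle_space g ->
    exists c : bidx -> int, g = \sum_k cycle k *~ c k
}.

(* The ambient space R^A x R^B; R^o is R as a module over itself. *)
Definition point (R : realType) (G : digraph) (B : cycle_basis G) :=
  ({ffun arc G -> R^o} * {ffun bidx B -> R^o})%type.

Definition polytope (R : realType) (I : pesp R) (B : cycle_basis I) :
    set (point R B) :=
  [set p : point R B |
    (forall k, \sum_(a : arc I) (cycle k a)%:~R * p.1 a
               = (period I)%:R * p.2 k) /\
    (forall a, (lo a)%:~R <= p.1 a <= (up a)%:~R)].

Arguments polytope {R I} B.

Definition convex_hull (R : realType) (E : lmodType R) (S : set E) : set E :=
  smallest (@convex_set R E) S.

Definition split_closure (R : realType) (I : pesp R) (B : cycle_basis I) :
    set (point R B) :=
  \bigcap_(b in [set: bidx B -> int])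
    convex_hull [set p : point R B | polytope B p /\
      \sum_k (b k)%:~R * p.2 k \is a Num.int].

Arguments split_closure {R I} B.

(* I' arises from I by subdividing sub_arc.  The first half a1 is the image of
   sub_arc under sub_a, the second half a2 is sub_new_arc. *)
Record simple_subdivision (R : realType) (I I' : pesp R) := SimpleSubdivision {
  sub_arc : arc I;
  sub_v : vertex I -> vertex I';
  sub_a : arc I -> arc I';
  sub_new_vertex : vertex I';
  sub_new_arc : arc I';
  sub_v_inj : injective sub_v;
  sub_v_codom : forall v, (v \in codom sub_v) = (v != sub_new_vertex);
  sub_a_inj : injective sub_a;
  sub_a_codom : forall a, (a \in codom sub_a) = (a != sub_new_arc);
  sub_tail : forall a, tail (sub_a a) = sub_v (tail a);
  sub_head : forall a, a != sub_arc -> head (sub_a a) = sub_v (head a);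
  sub_head1 : head (sub_a sub_arc) = sub_new_vertex;
  sub_tail2 : tail sub_new_arc = sub_new_vertex;
  sub_head2 : head sub_new_arc = sub_v (head sub_arc);
  sub_period : period I' = period I;
  sub_lo_lt_up : lo sub_arc < up sub_arc;
  sub_bounds1 : 0 <= lo (sub_a sub_arc) <= up (sub_a sub_arc);
  sub_bounds2 : 0 <= lo sub_new_arc <= up sub_new_arc;
  sub_lo_sum : lo (sub_a sub_arc) + lo sub_new_arc = lo sub_arc;
  sub_up_sum : up (sub_a sub_arc) + up sub_new_arc = up sub_arc;
  sub_weight1 : weight (sub_a sub_arc) = weight sub_arc;
  sub_weight2 : weight sub_new_arc = weight sub_arc;
  sub_lo : forall a, a != sub_arc -> lo (sub_a a) = lo a;
  sub_up : forall a, a != sub_arc -> up (sub_a a) = up a;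
  sub_weight : forall a, a != sub_arc -> weight (sub_a a) = weight a
}.

Record subdivided_basis (R : realType) (I I' : pesp R)
    (s : simple_subdivision I I') (B : cycle_basis I) (B' : cycle_basis I') :=
  SubdividedBasis {
  sub_k : bidx B -> bidx B';
  sub_k_bij : bijective sub_k;
  sub_cycle : forall k a, cycle (sub_k k) (sub_a s a) = cycle k a;
  sub_cycle2 : forall k, cycle (sub_k k) (sub_new_arc s) = cycle k (sub_arc s)
}.

Definition summation_map (R : realType) (I I' : pesp R)
    (s : simple_subdivision I I') (B : cycle_basis I) (B' : cycle_basis I')
    (t : subdivided_basis s B B') (p : point R B') : point R B :=
  ([ffun a => if a == sub_arc s
              then p.1 (sub_a s (sub_arc s)) + p.1 (sub_new_arc s)
              else p.1 (sub_a s a)],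
   [ffun k => p.2 (sub_k t k)]).

(* I arises from I' by deleting the free arc aug_arc.  By aug_v_deleted, the
   vertices of I' outside the range of aug_v are end points of aug_arc that
   become isolated, and aug_v_unique says that there is at most one; that no
   isolated vertex is left over follows from the connectivity of I. *)
Record simple_free_augmentation (R : realType) (I I' : pesp R) :=
  SimpleFreeAugmentation {
  aug_arc : arc I';
  aug_v : vertex I -> vertex I';
  aug_a : arc I -> arc I';
  aug_v_inj : injective aug_v;
  aug_v_deleted : forall v, v \notin codom aug_v ->
    ((v == tail aug_arc) || (v == head aug_arc)) /\
    (forall a, a != aug_arc -> (tail a != v) && (head a != v));
  aug_v_unique : forall v w,
    v \notin codom aug_v -> w \notin codom aug_v -> v = w;
  aug_a_inj : injective aug_a;
  aug_a_codom : forall a, (a \in codom aug_a) = (a != aug_arc);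
  aug_tail : forall a, tail (aug_a a) = aug_v (tail a);
  aug_head : forall a, head (aug_a a) = aug_v (head a);
  aug_period : period I' = period I;
  aug_lo : forall a, lo (aug_a a) = lo a;
  aug_up : forall a, up (aug_a a) = up a;
  aug_weight : forall a, weight (aug_a a) = weight a;
  aug_free : up aug_arc - lo aug_arc = (period I')%:Z - 1
}.

(* B' is B, extended by 0, if the new arc is a bridge, and otherwise B together
   with one further oriented cycle containing the new arc. *)
Record augmented_basis (R : realType) (I I' : pesp R)
    (s : simple_free_augmentation I I')
    (B : cycle_basis I) (B' : cycle_basis I') := AugmentedBasis {
  aug_k : bidx B -> bidx B';
  aug_k_inj : injective aug_k;
  aug_cycle : forall k a, cycle (aug_k k) (aug_a s a) = cycle k a;
  aug_cycle0 : forall k, cycle (aug_k k) (aug_arc s) = 0;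
  aug_k_bridge : bridge (aug_arc s) -> forall k', k' \in codom aug_k;
  aug_k_nonbridge : ~~ bridge (aug_arc s) ->
    exists2 k0, cycle k0 (aug_arc s) != 0 &
      forall k', (k' \in codom aug_k) = (k' != k0)
}.

Definition natural_projection (R : realType) (I I' : pesp R)
    (s : simple_free_augmentation I I') (B : cycle_basis I)
    (B' : cycle_basis I') (t : augmented_basis s B B') (p : point R B') :
    point R B :=
  ([ffun a => p.1 (aug_a s a)], [ffun k => p.2 (aug_k t k)]).

Inductive expansion (R : realType) (I : pesp R) (B : cycle_basis I) :
    forall I' : pesp R, cycle_basis I' -> Type :=
| ExpansionNil : expansion B B
| ExpansionSubdivide (I1 I2 : pesp R) (B1 : cycle_basis I1)
    (B2 : cycle_basis I2) (e : expansion B B1)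
    (s : simple_subdivision I1 I2) (t : subdivided_basis s B1 B2) :
    expansion B B2
| ExpansionAugment (I1 I2 : pesp R) (B1 : cycle_basis I1)
    (B2 : cycle_basis I2) (e : expansion B B1)
    (s : simple_free_augmentation I1 I2) (t : augmented_basis s B1 B2) :
    expansion B B2.

Fixpoint composite_map (R : realType) (I : pesp R) (B : cycle_basis I)
    (I' : pesp R) (B' : cycle_basis I') (e : expansion B B') :
    point R B' -> point R B :=
  match e with
  | ExpansionNil => id
  | ExpansionSubdivide _ _ _ _ e' _ t => composite_map e' \o summation_map t
  | ExpansionAugment _ _ _ _ e' _ t => composite_map e' \o natural_projection t
  end.

(* Main.v *)
(* Since [z] is determined by [x], a point of the split closure is a point [x]
   of the box with a condition for every [g] in the cycle space: if the tension
   of [g] is [T * (n + t)] with [0 < t < 1], then [x] must be an average, with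
   weights [1 - t] and [t], of points of the box with tensions [T * n] and
   [T * (n + 1)].  This is a lower bound on a quantity [room x t g] that is
   nonnegative and concave in [t] and sublinear in [g], and it is equivalent to
   the flip inequalities of [g], which are linear in [x].

   Subdivision: the summation map has an affine section, which spreads the
   entry of the subdivided arc proportionally over the two halves.

   Free augmentation: the condition is inherited by conformal sums, so by
   conformal decomposition of circulations only those [g] matter whose
   coefficient at the new arc is 0 or 1.  For coefficient 1 each flip inequality
   is a lower or an upper bound on the entry of the new arc.  If the lower bound
   of [g1] exceeded the upper bound of [g2], the condition for [g1 - g2], which
   avoids the new arc, would fail (here [up - lo = T - 1] and the integrality of
   the bounds enter); so the supremum of the lower bounds is a valid entry. *)
From mathcomp Require Import all_boot all_order all_algebra.
From mathcomp Require Import boolp classical_sets reals interval_inference convex.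
From mathcomp Require Import ring lra zify.
Require Import Defs.

Set Implicit Arguments.
Unset Strict Implicit.
Unset Printing Implicit Defensive.

Import Order.TTheory GRing.Theory Num.Theory.

Local Open Scope classical_set_scope.
Local Open Scope ring_scope.

(** * Flip inequalities and splittings of points of a box *)

Section FlipInequalities.
Context (R : realType) (A : finType) (lo up : A -> int) (T : nat).
Implicit Types (g h : A -> int) (x : A -> R) (f : A -> bool) (t : R) (a : A).

Definition pos (i : int) : R := (Num.max i 0)%:~R.

Lemma pos_ge0 i : 0 <= pos i.
Proof. by rewrite ler0z le_max lexx orbT. Qed.

Lemma pos_id (i : int) : 0 <= i -> pos i = i%:~R.
Proof. by move=> i0; rewrite /pos max_l. Qed.

Lemma pos_eq0 (i : int) : i <= 0 -> pos i = 0.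
Proof. by move=> i0; rewrite /pos max_r. Qed.

Lemma pos_subN i : pos i - pos (- i) = i%:~R.
Proof.
have [i0|/ltW i0] := leP 0 i.
  by rewrite pos_id // pos_eq0 ?oppr_le0 // subr0.
by rewrite pos_eq0 // pos_id ?oppr_ge0 // sub0r mulrNz opprK.
Qed.

Lemma pos_add i j : pos (i + j) <= pos i + pos j.
Proof. rewrite /pos -intrD ler_int; lia. Qed.

Definition in_box x := forall a, (lo a)%:~R <= x a <= (up a)%:~R.

(** The first point of the average must stay above [lo] and the second below [up]; this limits the
    drop of coordinate [a] at the first point, scaled by [1 - t]. The same with [1 - t] for [t]
    limits a rise. *)
Definition cap x t a : R :=
  Num.min ((1 - t) * (x a - (lo a)%:~R)) (t * ((up a)%:~R - x a)).

(* The largest amount by which the tension of [g] can be lowered when [x] moves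
   to a point [p0] of the box such that [x] is the average of [p0] and a second
   point of the box with weights [1 - t] and [t]; scaled by [1 - t]. *)
Definition room x t g : R :=
  \sum_a (pos (g a) * cap x t a + pos (- g a) * cap x (1 - t) a).

(** Going from [T * (n + t)] down to [T * n] is a change of [T * t]; the scaling of [room] by
    [1 - t] gives the left-hand side. *)
Definition splittable x g := forall (n : int) t, 0 <= t <= 1 ->
  \sum_a (g a)%:~R * x a = T%:R * (n%:~R + t) ->
  T%:R * (t * (1 - t)) <= room x t g.

Definition bound f a : int := if f a then lo a else up a.

(** For [x] in the box, the sum of the positive parts of [g a * (x a - bound f a)]; the [rise] of
    [- g] sums the negative parts. *)
Definition rise x g f : R :=
  \sum_a (if f a then pos (g a) * (x a - (lo a)%:~R)
          else pos (- g a) * ((up a)%:~R - x a)).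

Definition offset g f : int := ((- \sum_a g a * bound f a)%R %% T%:Z)%Z.

(** For constantly true [f] this is the change-cycle inequality; a general [f] amounts to reversing
    the arcs where [f] is false. *)
Definition flip x g f :=
  let al : R := (offset g f)%:~R in
  al * (T%:R - al) <=
    (T%:R - al) * rise x g f + al * rise x (fun a => - g a) f.

Lemma rise_ge0 x g f : in_box x -> 0 <= rise x g f.
Proof.
move=> bx; apply: sumr_ge0 => a _; have /andP[? ?] := bx a.
by case: ifP => _; rewrite mulr_ge0 ?pos_ge0 ?subr_ge0.
Qed.

Lemma rise_sub x g f :
  rise x g f - rise x (fun a => - g a) f =
  \sum_a (g a)%:~R * x a - (\sum_a g a * bound f a)%:~R.
Proof.
rewrite rmorph_sum -!sumrB /=; apply: eq_bigr => a _.
by rewrite rmorphM /= -(pos_subN (g a)) /bound opprK; case: ifP => _; ring.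
Qed.

Lemma offsetP g f : (0 < T)%N ->
  exists q : int, 0 <= offset g f < T%:Z /\
    - \sum_a g a * bound f a = q * T%:Z + offset g f.
Proof.
move=> T0; exists ((- \sum_a g a * bound f a)%R %/ T%:Z)%Z; split.
  by rewrite /offset modz_ge0 ?ltz_pmod //; lia.
exact: divz_eq.
Qed.

Lemma rise_sub_offset x g f (n : int) t : (0 < T)%N ->
  \sum_a (g a)%:~R * x a = T%:R * (n%:~R + t) ->
  exists j : int, rise x g f - rise x (fun a => - g a) f =
    T%:R * t + (offset g f)%:~R + T%:R * j%:~R.
Proof.
move=> T0 e; have [q [_ eq]] := offsetP g f T0; exists (n + q).
rewrite rise_sub e -[X in _ - X%:~R]opprK eq mulrNz !intrD intrM.
by rewrite -pmulrn; ring.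
Qed.

Lemma room_le_rise x t g f : in_box x -> 0 <= t <= 1 ->
  room x t g <= (1 - t) * rise x g f + t * rise x (fun a => - g a) f.
Proof.
move=> bx /andP[t0 t1]; rewrite !mulr_sumr -big_split /=.
apply: ler_sum => a _; rewrite /cap opprK.
have := pos_ge0 (g a); have := pos_ge0 (- g a).
move: (pos (g a)) (pos (- g a)) => u v v0 u0.
have -> : 1 - (1 - t) = t by ring.
case: ifP => _; rewrite !mulrA.
  rewrite ![_ * u]mulrC ![_ * v]mulrC -!mulrA.
  by apply: lerD; apply: ler_wpM2l => //; rewrite ge_min lexx ?orbT.
rewrite ![_ * u]mulrC ![_ * v]mulrC -!mulrA addrC.
by apply: lerD; apply: ler_wpM2l => //; rewrite ge_min lexx ?orbT.
Qed.

(** [f] records which of the two terms attains the minimum in each [cap]. With [room_le_rise],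
    [room] is the minimum of such combinations over all [f]. *)
Lemma room_attained x t g :
  exists f, room x t g = (1 - t) * rise x g f + t * rise x (fun a => - g a) f.
Proof.
pose c s a := ((1 - s) * (x a - (lo a)%:~R) <= s * ((up a)%:~R - x a)).
exists (fun a => if 0 <= g a then c t a else c (1 - t) a).
rewrite !mulr_sumr -big_split /=; apply: eq_bigr => a _.
have e : 1 - (1 - t) = t by ring.
rewrite /cap opprK e; have [g0|/ltW g0] := leP 0 (g a).
  rewrite [pos (- _)]pos_eq0 ?oppr_le0 // !mul0r /c.
  by case: leP => _; ring.
rewrite [pos (g a)]pos_eq0 // !mul0r /c e.
by case: leP => _ /=; ring.
Qed.

(** For [j >= 0] the [P] term alone suffices, for [j <= -2] the [Q] term. For [j = -1], eliminating
    [Q] turns both the flip inequality and the goal into [al * t <= P]. *)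
Lemma flip_core (al P Q t : R) (j : int) : (0 < T)%N ->
  0 <= al < T%:R -> 0 <= t <= 1 -> 0 <= P -> 0 <= Q ->
  P - Q = T%:R * t + al + T%:R * j%:~R ->
  al * (T%:R - al) <= (T%:R - al) * P + al * Q ->
  T%:R * (t * (1 - t)) <= (1 - t) * P + t * Q.
Proof.
move=> T0' /andP[al0 alT] /andP[t0 t1] P0 Q0 e fl.
have T0 : 0 < T%:R :> R by rewrite ltr0n.
move: (T%:R) T0 alT e fl => S T0 alT e fl.
have [j0|j0] := leP 0 j.
  have j0' : 0 <= j%:~R :> R by rewrite ler0z.
  have : S * t <= P by have := mulr_ge0 (ltW T0) j0'; lra.
  by nra.
have [jE|j1] := eqVneq j (-1).
  rewrite jE in e.
  have eQ : Q = P - (S * t + al - S) by lra.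
  have : al * t <= P.
    rewrite -(ler_pM2l T0); move: fl; rewrite eQ; nra.
  by rewrite eQ; nra.
have j2 : j%:~R <= -2 :> R.
  have: j <= -2 by lia.
  by rewrite -(ler_int R).
have : S - S * t <= Q by have := ler_wpM2l (ltW T0) j2; lra.
by nra.
Qed.

Lemma flip_splittable x g : (0 < T)%N -> in_box x ->
  (forall f, flip x g f) -> splittable x g.
Proof.
move=> T0 bx fl n t t01 e; have [f ->] := room_attained x t g.
have [j e'] := rise_sub_offset f T0 e.
have [_ [/andP[o0 oT] _]] := offsetP g f T0.
apply: flip_core e' (fl f) => //; rewrite ?rise_ge0 //.
by rewrite ler0z o0 /= pmulrn ltr_int.
Qed.

(** Exchanging the two points of the average swaps their weights and the direction of the move. *)
Lemma roomN x t g : room x (1 - t) (fun a => - g a) = room x t g.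
Proof.
by apply: eq_bigr => a _; rewrite opprK addrC; congr (_ * cap _ _ _ + _); ring.
Qed.

Lemma cap_ge0 x t a : in_box x -> 0 <= t <= 1 -> 0 <= cap x t a.
Proof.
move=> bx /andP[t0 t1]; have /andP[? ?] := bx a.
by rewrite le_min !mulr_ge0 ?subr_ge0.
Qed.

Lemma room_ge0 x t g : in_box x -> 0 <= t <= 1 -> 0 <= room x t g.
Proof.
move=> bx t01; apply: sumr_ge0 => a _.
by rewrite addr_ge0 // mulr_ge0 ?pos_ge0 ?cap_ge0 //; lra.
Qed.

Lemma splittableN x g : splittable x g -> splittable x (fun a => - g a).
Proof.
move=> sg n t t01 e; rewrite -roomN.
have -> : room x (1 - t) (fun a => - - g a) = room x (1 - t) g.
  by apply: eq_bigr => a _; rewrite !opprK.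
have -> : t * (1 - t) = (1 - t) * (1 - (1 - t)) by ring.
(* [- (n + t)] is split as [(- n - 1) + (1 - t)]. *)
apply: (sg (- n - 1)); first lra.
rewrite intrD !mulrNz mulr1z.
have -> : T%:R * (- n%:~R - 1 + (1 - t)) = - (T%:R * (n%:~R + t)) by ring.
by rewrite -e -sumrN; apply: eq_bigr => a _; rewrite mulrNz mulNr opprK.
Qed.

Lemma scale_min_le (c d p q p' q' : R) : 0 <= c -> c * p <= d * p' ->
  c * q <= d * q' -> 0 <= d -> c * Num.min p q <= d * Num.min p' q'.
Proof. by move=> c0 cp cq d0; rewrite !minr_pMr // !(le_min, ge_min) cp cq ?orbT. Qed.

(** Concavity in [t] and nonnegativity at 1: [room x t g / (1 - t)] does not decrease. *)
Lemma room_concave1 x g s t : in_box x -> 0 <= s -> s <= t -> t <= 1 ->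
  (1 - t) * room x s g <= (1 - s) * room x t g.
Proof.
move=> bx s0 st t1; rewrite !mulr_sumr; apply: ler_sum => a _.
have /andP[b1 b2] := bx a.
rewrite !mulrDr ![_ * (pos _ * _)]mulrCA.
apply: lerD; apply: ler_wpM2l; rewrite ?pos_ge0 //; apply: scale_min_le; nra.
Qed.

(** The mirror image: [room x t g / t] does not increase. *)
Lemma room_concave0 x g s t : in_box x -> 0 <= s -> s <= t -> t <= 1 ->
  s * room x t g <= t * room x s g.
Proof.
move=> bx s0 st t1.
have := @room_concave1 x (fun a => - g a) (1 - t) (1 - s) bx.
have e u : 1 - (1 - u) = u :> R by ring.
by rewrite !roomN !e; apply; lra.
Qed.

Definition conformal g h := forall a, 0 <= g a * h a.

Lemma pos_conformal (i j : int) : 0 <= i * j -> pos (i + j) = pos i + pos j.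
Proof.
rewrite /pos -intrD => ij; congr (_%:~R).
have [i0|i0] := ltP 0 i; first by nia.
have [j0|j0] := ltP 0 j; first by nia.
by lia.
Qed.

Lemma roomD x t g h : conformal g h ->
  room x t (fun a => g a + h a) = room x t g + room x t h.
Proof.
move=> gh; rewrite -big_split; apply: eq_bigr => a _ /=.
rewrite opprD !pos_conformal ?mulrNN //; ring.
Qed.

Lemma room_subadditive x t g h : in_box x -> 0 <= t <= 1 ->
  room x t (fun a => g a + h a) <= room x t g + room x t h.
Proof.
move=> bx t01; rewrite -big_split; apply: ler_sum => a _ /=.
have c0 := cap_ge0 a bx t01.
have c1 : 0 <= cap x (1 - t) a by apply: cap_ge0 => //; lra.
rewrite opprD addrACA -!mulrDl.
by apply: lerD; apply: ler_wpM2r; rewrite ?pos_add.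
Qed.

Lemma frac_exists (y : R) : (0 < T)%N ->
  exists (n : int) t, 0 <= t < 1 /\ y = T%:R * (n%:~R + t).
Proof.
move=> T0; have T0' : T%:R != 0 :> R by rewrite pnatr_eq0 -lt0n.
exists (Num.floor (y / T%:R)), (y / T%:R - (Num.floor (y / T%:R))%:~R).
have /andP[fl fu] := floor_itv (y / T%:R).
split; last by field.
by rewrite subr_ge0 fl ltrBlDl; move: fu; rewrite intrD.
Qed.

(** For conformal summands [room] is additive. The fractional parts [s] and [r] satisfy [s + r = t]
    or [s + r = t + 1]; concavity carries both bounds to [t], from the left in the first case and
    from the right in the second. *)
Lemma splittableD x g h : (0 < T)%N -> in_box x -> conformal g h ->
  splittable x g -> splittable x h -> splittable x (fun a => g a + h a).
Proof.
move=> T0 bx gh sg sh n t t01.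
have [m [s [/andP[s0 s1] es]]] := frac_exists (\sum_a (g a)%:~R * x a) T0.
have [k [r [/andP[r0 r1] er]]] := frac_exists (\sum_a (h a)%:~R * x a) T0.
have -> : \sum_a (g a + h a)%:~R * x a =
    \sum_a (g a)%:~R * x a + \sum_a (h a)%:~R * x a.
  by rewrite -big_split; apply: eq_bigr => a _; rewrite intrD mulrDl.
rewrite es er -mulrDr => /(mulfI _) e.
have {}e : t = s + r + (m + k - n)%:~R.
  by rewrite !intrD mulrNz; have := e _; rewrite pnatr_eq0 -lt0n => /(_ T0); lra.
have S0 : 0 < T%:R :> R by rewrite ltr0n.
(* [t] may equal 1 whereas [s] and [r] are below 1; at 1 only [room >= 0] is claimed. *)
have [->|t1] := eqVneq t 1.
  by rewrite subrr !mulr0 room_ge0 // lexx ler01.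
have {}t1 : t < 1 by rewrite lt_neqAle t1; lra.
have := sg m s _ es; have := sh k r _ er; rewrite roomD //.
have -> : 0 <= s <= 1 by lra.
have -> : 0 <= r <= 1 by lra.
move=> /(_ isT) sr /(_ isT) ss.
have jle : (m + k - n) <= 0.
  by rewrite -ltzD1 -(ltr_int R) intrD; lra.
have jge : -1 <= (m + k - n).
  by rewrite -ltzD1 -(ltr_int R) intrD; lra.
have [j0|j0] := eqVneq (m + k - n) 0.
  move: e; rewrite j0 => e.
  have := @room_concave1 x g s t bx; have := @room_concave1 x h r t bx.
  have -> : r <= t by lra.
  have -> : s <= t by lra.
  move=> /(_ r0 isT (ltW t1)) cr /(_ s0 isT (ltW t1)) cs.
  have : T%:R * (s * (1 - t)) <= room x t g by nra.
  have : T%:R * (r * (1 - t)) <= room x t h by nra.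
  by rewrite e; nra.
have j1 : (m + k - n) = -1 by lia.
move: e; rewrite j1 => e.
have t0 : 0 <= t by lra.
have := @room_concave0 x g t s bx; have := @room_concave0 x h t r bx.
have -> : t <= r by lra.
have -> : t <= s by lra.
move=> /(_ t0 isT (ltW r1)) cr /(_ t0 isT (ltW s1)) cs.
have : T%:R * (t * (1 - s)) <= room x t g by nra.
have : T%:R * (t * (1 - r)) <= room x t h by nra.
by rewrite e; nra.
Qed.

(** Validity as a disjunctive cut: integrality leaves only [al <= P] or [T - al <= Q], and either
    one suffices. *)
Lemma flip_of_int x g f (n : int) : (0 < T)%N -> in_box x ->
  \sum_a (g a)%:~R * x a = T%:R * n%:~R -> flip x g f.
Proof.
move=> T0 bx e; have [_ [/andP[o0 oT] _]] := offsetP g f T0.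
have [|j] := @rise_sub_offset x g f n 0 T0; first by rewrite addr0.
rewrite mulr0 add0r /flip; have := rise_ge0 (fun a => - g a) f bx.
have := rise_ge0 g f bx.
have : 0 <= ((offset g f)%:~R : R) <= T%:R.
  by rewrite ler0z o0 /= pmulrn ler_int ltW.
move: ((offset g f)%:~R) (rise x _ f) (rise x g f) => al Q P.
move=> /andP[al0 alT] P0 Q0 {}e.
have S0 : 0 <= T%:R :> R by rewrite ler0n.
have [j0|j0] := leP 0 j.
  have : 0 <= j%:~R :> R by rewrite ler0z.
  move=> /(mulr_ge0 S0) h; have : al <= P by lra.
  by nra.
have : j%:~R <= -1 :> R by rewrite (_ : -1 = (-1)%:~R) // ler_int; lia.
move=> /(ler_wpM2l S0) h; have : T%:R - al <= Q by lra.
by nra.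
Qed.

Lemma rise_affine x y t g f :
  rise (fun a => t * x a + (1 - t) * y a) g f =
  t * rise x g f + (1 - t) * rise y g f.
Proof.
rewrite !mulr_sumr -big_split; apply: eq_bigr => a _ /=.
by case: ifP => _; ring.
Qed.

Lemma flip_convex x y t g f : 0 <= t <= 1 -> flip x g f -> flip y g f ->
  flip (fun a => t * x a + (1 - t) * y a) g f.
Proof.
move=> /andP[t0 t1]; rewrite /flip !rise_affine.
move: ((offset g f)%:~R) (rise x g f) (rise y g f) => al P P'.
move: (rise x _ f) (rise y _ f) => Q Q' hx hy.
have := lerD (ler_wpM2l t0 hx) (ler_wpM2l (_ : 0 <= 1 - t) hy).
by rewrite subr_ge0 => /(_ t1); lra.
Qed.

Lemma split_points x g (n : int) t : (0 < T)%N -> 0 < t < 1 -> in_box x ->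
  \sum_a (g a)%:~R * x a = T%:R * (n%:~R + t) ->
  T%:R * (t * (1 - t)) <= room x t g ->
  exists x0 x1, [/\ in_box x0, in_box x1,
    \sum_a (g a)%:~R * x0 a = T%:R * n%:~R,
    \sum_a (g a)%:~R * x1 a = T%:R * (n + 1)%:~R &
    forall a, x a = t * x1 a + (1 - t) * x0 a].
Proof.
move=> T0 /andP[t0 t1] bx e le_room.
have S0 : 0 < T%:R :> R by rewrite ltr0n.
have u0 : 0 < 1 - t by rewrite subr_gt0.
(* The move that realizes [room]: coordinates go down where [g] is positive and up where it is
   negative. *)
pose d a := if 0 < g a then cap x t a else
  if g a < 0 then - cap x (1 - t) a else 0.
have sum_d : \sum_a (g a)%:~R * d a = room x t g.
  apply: eq_bigr => a _; rewrite /d; case: ltgtP => ga.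
  - by rewrite pos_id ?ltW // pos_eq0; [ring | lia].
  - by rewrite pos_eq0 ?ltW // pos_id ?mulrNz; [ring | lia].
  - by rewrite -ga oppr0 pos_id //; ring.
have r0 : 0 < room x t g by apply: lt_le_trans le_room; rewrite !mulr_gt0.
move: r0 le_room sum_d; move: (room x t g) => r r0 le_room sum_d.
(* [s] shrinks the move so that the tension changes exactly as required; the two points are then
   [x - w0 * d] and [x + w1 * d]. *)
pose s := T%:R * (t * (1 - t)) / r.
have s0 : 0 <= s by rewrite divr_ge0 ?ltW // !mulr_gt0.
have s1 : s <= 1 by rewrite ler_pdivrMr // mul1r.
have sr : s * r = T%:R * (t * (1 - t)) by rewrite divfK // gt_eqF.
clearbody s.
pose w0 := s / (1 - t); pose w1 := s / t.
have ew0 : w0 * (1 - t) = s by rewrite divfK // gt_eqF.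
have ew1 : w1 * t = s by rewrite divfK // gt_eqF.
have w00 : 0 <= w0 by rewrite divr_ge0 // ltW.
have w10 : 0 <= w1 by rewrite divr_ge0 // ltW.
clearbody w0 w1.
have move_sum w : \sum_a (g a)%:~R * (x a + w * d a) = T%:R * (n%:~R + t) + w * r.
  by rewrite -e -sum_d mulr_sumr -big_split; apply: eq_bigr => a _ /=; ring.
have dbound a : [/\ - (1 - t) * (x a - (lo a)%:~R) <= - d a,
    - d a <= (1 - t) * ((up a)%:~R - x a),
    - t * (x a - (lo a)%:~R) <= d a & d a <= t * ((up a)%:~R - x a)].
  have /andP[b1 b2] := bx a; rewrite -subr_ge0 in b1; rewrite -subr_ge0 in b2.
  have c0 := @cap_ge0 x t a bx; have c1 := @cap_ge0 x (1 - t) a bx.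
  have {}c0 : 0 <= cap x t a by apply: c0; lra.
  have {}c1 : 0 <= cap x (1 - t) a by apply: c1; lra.
  have m0 : cap x t a <= (1 - t) * (x a - (lo a)%:~R) by rewrite ge_min lexx.
  have m1 : cap x t a <= t * ((up a)%:~R - x a) by rewrite ge_min lexx orbT.
  have m2 : cap x (1 - t) a <= t * (x a - (lo a)%:~R).
    by rewrite ge_min (_ : 1 - (1 - t) = t) ?lexx //; ring.
  have m3 : cap x (1 - t) a <= (1 - t) * ((up a)%:~R - x a).
    by rewrite ge_min lexx orbT.
  have p0 := mulr_ge0 (ltW u0) b1; have p1 := mulr_ge0 (ltW u0) b2.
  have p2 := mulr_ge0 (ltW t0) b1; have p3 := mulr_ge0 (ltW t0) b2.
  by rewrite /d; case: ifP => _; [|case: ifP => _]; split; lra.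
exists (fun a => x a + - w0 * d a), (fun a => x a + w1 * d a); split.
- move=> a; have [d1 d2 _ _] := dbound a; have /andP[b1 b2] := bx a.
  have h1 := ler_wpM2l w00 d1; have h2 := ler_wpM2l w00 d2.
  by apply/andP; split; nra.
- move=> a; have [_ _ d1 d2] := dbound a; have /andP[b1 b2] := bx a.
  have h1 := ler_wpM2l w10 d1; have h2 := ler_wpM2l w10 d2.
  by apply/andP; split; nra.
- rewrite move_sum; have : w0 * r = T%:R * t.
    by apply: (mulIf (negbT (gt_eqF u0))); rewrite mulrAC ew0 sr; ring.
  by lra.
- rewrite move_sum intrD; have : w1 * r = T%:R * (1 - t).
    by apply: (mulIf (negbT (gt_eqF t0))); rewrite mulrAC ew1 sr; ring.
  by lra.
- move=> a; have -> : t * (x a + w1 * d a) + (1 - t) * (x a + - w0 * d a) =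
    x a + (w1 * t - w0 * (1 - t)) * d a by ring.
  by rewrite ew0 ew1 subrr mul0r addr0.
Qed.

(** A violation means [P + c1 * Q1 + c2 * P2 < d]. Both coefficients are at least [d / (S - d)], for
    [c2] because [al1 <= S - 1], so the flip inequality [d * (S - d) <= (S - d) * P + d * Q] fails.
    The last hypothesis implies it. *)
Lemma gap_core (S al1 al2 P1 Q1 P2 Q2 : R) :
  0 <= al1 -> al1 <= S - 1 -> 0 <= al2 -> al2 <= S - 1 ->
  0 <= P1 -> 0 <= Q1 -> 0 <= P2 -> 0 <= Q2 ->
  (forall t, 0 <= t <= 1 -> S * t = S - (al1 - al2) + (P1 + Q2) - (Q1 + P2) ->
    S * (t * (1 - t)) <= ((1 - t) * P1 + t * Q1) + (t * P2 + (1 - t) * Q2)) ->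
  al1 - P1 - al1 / (S - al1) * Q1 <=
  al2 + Q2 + (S - 1 - al2) / (1 + al2) * P2.
Proof.
move=> a1 b1 a2 b2 p1 q1 p2 q2 H; rewrite leNgt; apply/negP.
set c1 := al1 / _; set c2 := _ / (1 + al2) => lt.
have d1 : 0 < S - al1 by lra.
have d2 : 0 < 1 + al2 by lra.
have e1 : c1 * (S - al1) = al1 by rewrite divfK // gt_eqF.
have e2 : c2 * (1 + al2) = S - 1 - al2 by rewrite divfK // gt_eqF.
have c10 : 0 <= c1 by apply: divr_ge0; lra.
have c20 : 0 <= c2 by apply: divr_ge0; lra.
clearbody c1 c2.
pose d := al1 - al2; pose P := P1 + Q2; pose Q := Q1 + P2.
have d0 : 0 < d by rewrite /d; nra.
have dS : d < S by rewrite /d; lra.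
have f1 : d <= (S - d) * c1 by rewrite /d -(ler_pM2r d1); nra.
have f2 : d <= (S - d) * c2 by rewrite /d -(ler_pM2r d2); nra.
have F : (S - d) * P + d * Q < d * (S - d).
  have g1 : d * Q1 <= (S - d) * c1 * Q1 by apply: ler_wpM2r.
  have g2 : d * P2 <= (S - d) * c2 * P2 by apply: ler_wpM2r.
  have : (S - d) * (P + c1 * Q1 + c2 * P2) < (S - d) * d.
    by rewrite ltr_pM2l /P /d; lra.
  by rewrite /Q; lra.
have P0 : 0 <= P by rewrite addr_ge0.
have Q0 : 0 <= Q by rewrite addr_ge0.
have S0 : 0 < S by lra.
(* [1 - w] is the only [t] that satisfies the equation in [H]. *)
pose w := (d - P + Q) / S.
have Sw : S * w = d - P + Q by rewrite mulrC divfK // gt_eqF.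
have Pd : P <= d by nra.
have w0 : 0 <= w by apply: divr_ge0; lra.
have w1 : w <= 1 by rewrite ler_pdivrMr // mul1r; nra.
have := H (1 - w); have -> : 0 <= 1 - w <= 1 by lra.
have -> : S * (1 - w) = S - (al1 - al2) + (P1 + Q2) - (Q1 + P2).
  by rewrite mulrBr Sw /d /P /Q; ring.
move=> /(_ isT erefl) h.
have : S * w <= Q + w * d.
  have e : S * w * w = (d - P + Q) * w by rewrite Sw.
  by move: h; rewrite /P /Q in e *; nra.
rewrite Sw => h2.
have : S * (d - P) <= d * (S * w) by nra.
by rewrite Sw; nra.
Qed.

(** * Choosing the entry of a free arc *)

Section FreeArc.
Context (C : (A -> int) -> Prop) (x : A -> R) (a0 : A).
Hypothesis subC : forall g h, C g -> C h -> C (fun a => g a - h a).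
Hypothesis box_x : in_box x.
Hypothesis x_a0 : x a0 = (lo a0)%:~R.
Hypothesis free_a0 : up a0 - lo a0 = T%:Z - 1.
Hypothesis T_gt0 : (0 < T)%N.
Hypothesis splitC : forall g, C g -> g a0 = 0 -> splittable x g.

Definition shift (y : R) a : R := x a + (a == a0)%:R * y.

Let al g f : R := (offset g f)%:~R.

(* The bounds that the flip inequalities of a [g] with [g a0 = 1] impose on the
   slack at [a0]; [f a0] decides which of the two one gets. *)
Let lb g f : R := al g f - rise x g f
  - al g f / (T%:R - al g f) * rise x (fun a => - g a) f.

Let ub g f : R := al g f + rise x (fun a => - g a) f
  + (T%:R - 1 - al g f) / (1 + al g f) * rise x g f.

Let up_a0 : (up a0)%:~R = (lo a0)%:~R + T%:R - 1 :> R.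
Proof.
have -> : up a0 = lo a0 + T%:Z - 1 by lia.
by rewrite !intrD mulrNz -pmulrn mulr1z.
Qed.

Let al_bounds g f : 0 <= al g f /\ al g f <= T%:R - 1.
Proof.
have [_ [/andP[o0 oT] _]] := offsetP g f T_gt0.
rewrite /al ler0z; split=> //.
have : offset g f + 1 <= T%:Z by lia.
by rewrite -(ler_int R) intrD -pmulrn; lra.
Qed.

Lemma lb_le_ub g1 f1 g2 f2 : C g1 -> C g2 -> g1 a0 = 1 -> g2 a0 = 1 ->
  lb g1 f1 <= ub g2 f2.
Proof.
move=> Cg1 Cg2 g1a g2a.
have [a1 b1] := al_bounds g1 f1; have [a2 b2] := al_bounds g2 f2.
apply: gap_core; rewrite ?rise_ge0 // => t t01 e.
have sp : splittable x (fun a => g1 a - g2 a).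
  by apply: splitC; [exact: subC | rewrite g1a g2a subrr].
have t01' : 0 <= 1 - t <= 1 by lra.
have [q1 [_ e1]] := offsetP g1 f1 T_gt0.
have [q2 [_ e2]] := offsetP g2 f2 T_gt0.
(* By [e] the tension of [g1 - g2] is [T * (q2 - q1 - 1 + t)]; the [- 1] cancels the summand [S] in
   the equation of [gap_core]. *)
apply: (le_trans (sp (q2 - q1 - 1) t t01 _)); last first.
  apply: (le_trans (@room_subadditive x t g1 (fun a => - g2 a) box_x t01)).
  apply: lerD; first exact: room_le_rise.
  have := @room_le_rise x (1 - t) g2 f2 box_x t01'.
  have <- := @roomN x (1 - t) g2.
  by have -> : 1 - (1 - t) = t by ring.
have -> : \sum_a (g1 a - g2 a)%:~R * x a =
    \sum_a (g1 a)%:~R * x a - \sum_a (g2 a)%:~R * x a.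
  by rewrite -sumrB; apply: eq_bigr => a _; rewrite intrB mulrBl.
have := rise_sub x g1 f1; have := rise_sub x g2 f2.
have -> : \sum_a g1 a * bound f1 a = - (q1 * T%:Z + offset g1 f1) by rewrite -e1 opprK.
have -> : \sum_a g2 a * bound f2 a = - (q2 * T%:Z + offset g2 f2) by rewrite -e2 opprK.
rewrite mulrDr e /al; move: (offset g1 f1) (offset g2 f2) => o1 o2.
rewrite !mulrNz !intrD !mulrNz !intrM -!pmulrn mulr1n.
lra.
Qed.

(** Since [x] is at the lower bound of [a0], switching [a0] to that bound removes its contribution
    and isolates the part that depends on [y]. *)
Lemma rise_shift y g f :
  rise (shift y) g f = rise x g (fun a => (a == a0) || f a) +
    (if f a0 then pos (g a0) * y else pos (- g a0) * (T%:R - 1 - y)).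
Proof.
rewrite /rise (bigD1 a0) //= [in RHS](bigD1 a0) //= eqxx /=.
rewrite (eq_bigr (fun a => if (a == a0) || f a
    then pos (g a) * (x a - (lo a)%:~R)
    else pos (- g a) * ((up a)%:~R - x a))); last first.
  by move=> a /negPf na; rewrite /shift na mul0r addr0.
by rewrite /shift eqxx x_a0 up_a0 mul1r; case: ifP => _; ring.
Qed.

(** Switching [a0] from upper to lower bound adds [T - 1], that is [-1] modulo [T], to the residue;
    the second case is the wrap-around. *)
Lemma offset_switch g f : g a0 = 1 -> ~~ f a0 ->
  let f' := fun a => (a == a0) || f a in
  offset g f = offset g f' + 1 \/
  offset g f = 0 /\ offset g f' = T%:Z - 1.
Proof.
move=> ga fa f'.
have [q [b e]] := offsetP g f T_gt0; have [q' [b' e']] := offsetP g f' T_gt0.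
have : \sum_a g a * bound f a = \sum_a g a * bound f' a + (T%:Z - 1).
  rewrite (bigD1 a0) //= [in RHS](bigD1 a0) //= /bound /f' eqxx (negPf fa) ga.
  rewrite -free_a0 (eq_bigr (fun a => g a * (if (a == a0) || f a then lo a else up a))).
    by ring.
  by move=> a /negPf ->.
move=> eS; have eq : (q' - q - 1) * T%:Z = offset g f - offset g f' - 1 by lia.
move: b b' eq; move: (offset g f) (offset g f') (q' - q - 1) => o o' j.
move=> /andP[o0 oT] /andP[o0' oT'] eq.
have [j0|j0] := eqVneq j 0; first by left; rewrite j0 in eq; lia.
have [j1|j1] := eqVneq j (-1); first by right; rewrite j1 in eq; lia.
exfalso; have [jp|jn] := ltP 0 j.
  have : 1 * T%:Z <= j * T%:Z by apply: ler_wpM2r => //; lia.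
  lia.
have : j * T%:Z <= -2 * T%:Z by apply: ler_wpM2r => //; lia.
lia.
Qed.

Lemma splittable_shift y : 0 <= y <= T%:R - 1 ->
  forall g, C g -> g a0 = 1 ->
  (forall f, lb g f <= y <= ub g f) -> splittable (shift y) g.
Proof.
move=> /andP[y0 y1] g Cg ga H; apply: flip_splittable => // [a|f].
  have := box_x a; rewrite /shift; case: eqVneq => [->|]; last by rewrite mul0r addr0.
  by rewrite up_a0 x_a0 mul1r; lra.
have pos1 : pos 1 = 1 by rewrite pos_id.
have posN1 : pos (-1) = 0 by rewrite pos_eq0.
(* Both cases are expressed through [f']: if [f a0] holds, flip at [f] is the bound [lb g f'], and
   otherwise it follows from [ub g f']. *)
set f' := fun a => (a == a0) || f a.
have := H f'; rewrite /lb /ub /flip !rise_shift opprK ga pos1 posN1 -/f' mul1r mul0r.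
have [a1 b1] := al_bounds g f'.
have P0 := @rise_ge0 x g f' box_x.
have Q0 := @rise_ge0 x (fun a => - g a) f' box_x.
case fa: (f a0) => /=.
  have -> : offset g f = offset g f'.
    congr (- _ %% _)%Z; apply: eq_bigr => a _; rewrite /bound /f'.
    by case: eqVneq => [->|//]; rewrite fa.
  rewrite -/(al g f') => /andP[h _]; rewrite mul0r addr0.
  have d0 : 0 < T%:R - al g f' by lra.
  move: h; rewrite -(ler_pM2l d0) mulrBr mulrA [_ * (_ / _)]mulrC divfK ?gt_eqF //.
  by lra.
(* After a wrap-around the offset is 0 and the flip inequality only says that a [rise] is
   nonnegative. *)
have [->|[-> e]] := @offset_switch g f ga (negbT fa); last first.
  by rewrite mulr0z !mul0r subr0 !addr0 mulr_ge0.
have -> : (offset g f' + 1)%:~R = al g f' + 1 by exact: intrD.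
move=> /andP[_ h]; rewrite addr0.
have d0 : 0 < 1 + al g f' by lra.
move: h; rewrite -(ler_pM2l d0) [X in _ <= X -> _]mulrDr.
rewrite [(1 + _) * (_ / _ * _)]mulrA [(1 + _) * (_ / _)]mulrC divfK ?gt_eqF //.
by lra.
Qed.

(** Lower bounds never exceed [T - 1] and upper bounds are never negative, so the supremum stays in
    the box even with 0 added to the set, and below all upper bounds. *)
Lemma exists_shift : exists y, 0 <= y <= T%:R - 1 /\
  forall g, C g -> g a0 = 1 -> splittable (shift y) g.
Proof.
(* No [g] in [C] has [g a0 = 1] when [a0] is a bridge, hence the extra [0]. *)
pose E := [set y : R | y = 0 \/
  exists g f, [/\ C g, g a0 = 1 & y = lb g f]].
have S1 : 1 <= T%:R :> R by rewrite ler1n.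
have E0 : E !=set0 by exists 0; left.
have lbT g f : lb g f <= T%:R - 1.
  have [a1 b1] := al_bounds g f.
  have P0 := @rise_ge0 x g f box_x.
  have Q0 := @rise_ge0 x (fun a => - g a) f box_x.
  rewrite /lb; have : 0 <= al g f / (T%:R - al g f) * rise x (fun a => - g a) f.
    by rewrite !mulr_ge0 ?invr_ge0 //; lra.
  by lra.
have ub0 g f : 0 <= ub g f.
  have [a1 b1] := al_bounds g f.
  have P0 := @rise_ge0 x g f box_x.
  have Q0 := @rise_ge0 x (fun a => - g a) f box_x.
  by rewrite !addr_ge0 // !mulr_ge0 ?invr_ge0 //; lra.
have ET : ubound E (T%:R - 1).
  by move=> _ [->|[g [f [_ _ ->]]]]; [lra | exact: lbT].
have supE : has_ubound E by exists (T%:R - 1).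
have y01 : 0 <= sup E <= T%:R - 1.
  by rewrite ge_sup // andbT; apply: ub_le_sup => //; left.
exists (sup E); split=> // g Cg ga; apply: splittable_shift => // f.
apply/andP; split; first by apply: ub_le_sup => //; right; exists g, f.
apply: ge_sup => // _ [->|[h [k [Ch ha ->]]]]; first exact: ub0.
exact: lb_le_ub.
Qed.

End FreeArc.

End FlipInequalities.

(** * Circulations and conformal decomposition *)

Definition balanced (G : digraph) (g : arc G -> int) := forall i : vertex G,
  \sum_(a | tail a == i) g a = \sum_(a | head a == i) g a.

Definition excess (G : digraph) (g : arc G -> int) (i : vertex G) : int :=
  \sum_a g a * ((tail a == i)%:Z - (head a == i)%:Z).

Section Circulations.
Context (G : digraph).
Implicit Types (g h : arc G -> int) (a b : arc G) (i j : vertex G).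

Lemma excessE g i :
  excess g i = \sum_(a | tail a == i) g a - \sum_(a | head a == i) g a.
Proof.
rewrite [X in _ = X - _]big_mkcond [X in _ = _ - X]big_mkcond /= -sumrB.
apply: eq_bigr => a _; rewrite mulrBr.
by do 2 case: ifP => _; rewrite ?mulr1 ?mulr0.
Qed.

Lemma balancedP g : balanced g <-> forall i, excess g i = 0.
Proof.
split=> bg i; have := bg i; rewrite excessE; first by move=> ->; rewrite subrr.
by move/eqP; rewrite subr_eq0 => /eqP.
Qed.

Lemma excessD g h i : excess (fun a => g a + h a) i = excess g i + excess h i.
Proof. by rewrite -big_split; apply: eq_bigr => a _; rewrite mulrDl. Qed.

Lemma excessN g i : excess (fun a => - g a) i = - excess g i.
Proof. by rewrite -sumrN; apply: eq_bigr => a _; rewrite mulNr. Qed.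

Lemma excess_delta b (n : int) i : excess (fun a => if a == b then n else 0) i =
  n * ((tail b == i)%:Z - (head b == i)%:Z).
Proof.
rewrite /excess (bigD1 b) //= eqxx big1 ?addr0 // => a /negPf ->.
by rewrite mul0r.
Qed.

(** End points in the direction of the flow: arcs with negative [g] are traversed backwards. *)
Definition src g a := if 0 < g a then tail a else head a.
Definition dst g a := if 0 < g a then head a else tail a.
Definition arc_step g : rel (vertex G) := fun i j =>
  [exists a, [&& g a != 0, src g a == i & dst g a == j]].

(** Send one unit along the path. The clause on [src] locates the support, which shows that an arc
    added later is not already in use. *)
Lemma path_flow g i p : path (arc_step g) i p -> uniq (i :: p) ->
  exists h,
  [/\ forall b, (0 <= h b <= Num.max 0 (Num.min 1 (g b)))
        || (Num.min 0 (Num.max (-1) (g b)) <= h b <= 0),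
      forall b, h b != 0 -> src g b \in belast i p &
      forall v, excess h v = (v == i)%:Z - (v == last i p)%:Z].
Proof.
elim: p i => [|j p IH] i.
  move=> _ _; exists (fun=> 0); split=> [b|b|v]; first by lia.
    by rewrite eqxx.
  by rewrite subrr /excess big1 // => a _; rewrite mul0r.
move=> /= /andP[/existsP[b /and3P[b0 /eqP sb /eqP db]] pp] /andP[ni up].
have [h [hb hs he]] := IH j pp up.
have hb0 : h b = 0.
  apply/eqP/negPn/negP => /hs; rewrite sb => /mem_belast; exact/negP.
exists (fun a => h a + (if a == b then Num.sg (g b) else 0)); split=> [a|a|v].
- case: (eqVneq a b) => [->|_]; last by rewrite addr0.
  rewrite hb0 add0r; case: (ltgtP (g b) 0) b0 => // gb _.
    by rewrite ltr0_sg //; lia.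
  by rewrite gtr0_sg //; lia.
- case: (eqVneq a b) => [->|_]; first by rewrite sb inE eqxx.
  by rewrite addr0 => /hs; rewrite inE orbC => ->.
- rewrite excessD excess_delta he -sb -db /src /dst.
  case: (ltgtP (g b) 0) b0 => // gb _.
    by rewrite ltr0_sg // !(eq_sym v); lia.
  by rewrite gtr0_sg // !(eq_sym v); lia.
Qed.

(** No flow leaves the set [S] of vertices reachable from [dst g a]. By balance none enters it
    either, so [a], which ends in [S], also starts there. *)
Lemma connect_dst_src g a : balanced g -> g a != 0 ->
  connect (arc_step g) (dst g a) (src g a).
Proof.
move=> /balancedP bg ga; pose S v := connect (arc_step g) (dst g a) v.
have step b : g b != 0 -> S (src g b) -> S (dst g b).
  move=> gb Sb; apply: connect_trans Sb (connect1 _).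
  by apply/existsP; exists b; rewrite gb !eqxx.
have sumS (i : vertex G) : \sum_(v | S v) ((i == v)%:Z) = (S i)%:Z.
  rewrite big_mkcond (bigD1 i) //= eqxx big1 ?addr0; first by case: (S i).
  by move=> v /negPf nv; rewrite eq_sym nv; case: (S v).
have e : \sum_b - (g b * ((S (tail b))%:Z - (S (head b))%:Z)) = 0.
  rewrite sumrN.
  rewrite (eq_bigr (fun b =>
    \sum_(v | S v) g b * ((tail b == v)%:Z - (head b == v)%:Z))).
    by rewrite exchange_big /= big1 ?oppr0 // => v _; exact: bg.
  by move=> b _; rewrite -mulr_sumr sumrB !sumS.
have pos0 b : 0 <= - (g b * ((S (tail b))%:Z - (S (head b))%:Z)).
  have := step b; rewrite /src /dst; case: (ltgtP (g b) 0) => [gb|gb|->] /=.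
  - by move=> /(_ isT); case: (S (tail b)); case: (S (head b)) => //= H;
      try (by have := H isT); lia.
  - by move=> /(_ isT); case: (S (tail b)); case: (S (head b)) => //= H;
      try (by have := H isT); lia.
  - by rewrite mul0r oppr0.
move/eqP: e; rewrite psumr_eq0 // => /allP /(_ a); rewrite mem_index_enum.
move=> /(_ isT) /= /eqP e.
have Sd : S (dst g a) by exact: connect0.
change (S (src g a)); move: Sd e ga; rewrite /src /dst.
by case: ifP => _; case: (S (tail a)); case: (S (head a)) => //= _ ? /eqP; lia.
Qed.

(** A simple path along the flow from [dst g a] back to [src g a] is closed by [a] itself. *)
Lemma conformal_cycle g a : balanced g -> 0 < g a ->
  exists h, [/\ balanced h, h a = 1 & conformal h (fun b => g b - h b)].
Proof.
move=> bg ga; have ga0 : g a != 0 by rewrite gt_eqF.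
have /connectP[p0 pp0 lp0] := connect_dst_src bg ga0.
case/shortenP: pp0 lp0 => p pp up _ lp.
have [h [hb hs he]] := path_flow pp up.
have ha : h a = 0.
  apply/eqP/negPn/negP => /hs; rewrite lp.
  by move: up; rewrite lastI rcons_uniq => /andP[/negP].
exists (fun b => h b + (if b == a then 1 else 0)); split=> [||b].
- apply/balancedP => v; rewrite excessD excess_delta he -lp /src /dst ga.
  by rewrite !(eq_sym v); lia.
- by rewrite ha eqxx.
- case: (eqVneq b a) => [->|_]; first by rewrite ha; lia.
  by rewrite addr0; have := hb b; nia.
Qed.

End Circulations.

(** * Convex hulls and affine maps *)

Section ConvexHull.
Context (R : realType).
Implicit Types E F : lmodType R.

Lemma convex_hull_min E (S X : set E) :
  (forall x y (t : R), 0 <= t <= 1 -> X x -> X y -> X (t *: x + (1 - t) *: y)) ->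
  S `<=` X -> convex_hull S `<=` X.
Proof.
move=> cX; apply: smallest_sub => x y l; rewrite !inE; apply: cX.
by rewrite ge0 le1.
Qed.

Lemma convex_hull_conv E (S : set E) x y (t : R) : 0 <= t <= 1 ->
  convex_hull S x -> convex_hull S y -> convex_hull S (t *: x + (1 - t) *: y).
Proof.
move=> /andP[t0 t1] hx hy X [cX SX].
have := cX x y (Itv01 t0 t1); rewrite !inE; apply; [exact: hx | exact: hy].
Qed.

Lemma convex_hull_image E F (f : E -> F) (S : set E) (S' : set F) :
  (forall x y (t : R), f (t *: x + (1 - t) *: y) = t *: f x + (1 - t) *: f y) ->
  (forall x, S x -> S' (f x)) -> forall x, convex_hull S x -> convex_hull S' (f x).
Proof.
move=> af SS'; apply: convex_hull_min => [x y t t01 hx hy|x Sx].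
  by rewrite af; exact: convex_hull_conv.
by apply: sub_gen_smallest; exact: SS'.
Qed.

End ConvexHull.

(** * The split closure in terms of splittable circulations *)

Section SplitClosure.
Context (R : realType) (I : pesp R) (B : cycle_basis I).
Implicit Types (b : bidx B -> int) (p : point R B) (x : arc I -> R).

Lemma period_gt0 : (0 < period I)%N.
Proof. exact: leq_trans (period_ge2 I). Qed.

Definition combination b (a : arc I) : int := \sum_k b k * cycle k a.

Lemma balanced_combination b : balanced (combination b).
Proof.
apply/balancedP => i; rewrite /excess /combination.
under eq_bigr do rewrite mulr_suml.
rewrite exchange_big big1 // => k _ /=.
under eq_bigr do rewrite -mulrA.
rewrite -mulr_sumr; have [/balancedP c _] := cycle_oriented k.
by have := c i; rewrite /excess => ->; rewrite mulr0.
Qed.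

Lemma balanced_span (g : arc I -> int) : balanced g ->
  exists b, forall a, g a = combination b a.
Proof.
move=> bg; have [|b e] := @cycle_span _ B [ffun a => g a].
  by move=> i /=; under eq_bigr do rewrite ffunE; rewrite bg;
    apply: eq_bigr => a _; rewrite ffunE.
exists b => a; have := congr1 (fun h : {ffun _} => h a) e.
rewrite ffunE sum_ffunE => ->; apply: eq_bigr => k _.
by rewrite ffunMzE mulrzz mulrC.
Qed.

Lemma tension_combination b p : polytope B p ->
  \sum_a (combination b a)%:~R * p.1 a =
  (period I)%:R * \sum_k (b k)%:~R * p.2 k.
Proof.
move=> [cyc _]; rewrite mulr_sumr.
under eq_bigr do rewrite rmorph_sum /= mulr_suml.
rewrite exchange_big; apply: eq_bigr => k _ /=.
rewrite mulrCA -cyc mulr_sumr; apply: eq_bigr => a _.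
by rewrite intrM mulrA.
Qed.

Definition lift x : point R B :=
  ([ffun a => x a],
   [ffun k => (\sum_a (cycle k a)%:~R * x a) / (period I)%:R]).

Lemma polytope_lift x : in_box (@lo R I) (@up R I) x -> polytope B (lift x).
Proof.
move=> bx; split=> [k|a]; rewrite !ffunE; last exact: bx.
rewrite mulrC divfK; last by rewrite pnatr_eq0 -lt0n period_gt0.
by apply: eq_bigr => a _; rewrite ffunE.
Qed.

Lemma polytopeE p : polytope B p -> p = lift p.1.
Proof.
case: p => x z [cyc _]; congr (_, _); apply/ffunP => k; rewrite ffunE // cyc.
by rewrite mulrC mulKf // pnatr_eq0 -lt0n period_gt0.
Qed.

Lemma lift_affine x y t : lift (fun a => t * x a + (1 - t) * y a) =
  t *: lift x + (1 - t) *: lift y.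
Proof.
congr (_, _); apply/ffunP => k; rewrite !ffunE //.
rewrite /GRing.scale /= !mulrA -mulrDl !mulr_sumr -big_split; congr (_ / _).
by apply: eq_bigr => a _ /=; ring.
Qed.

Lemma polytope_convex p q (t : R) : 0 <= t <= 1 ->
  polytope B p -> polytope B q -> polytope B (t *: p + (1 - t) *: q).
Proof.
move=> t01 Pp Pq; rewrite (polytopeE Pp) (polytopeE Pq) -lift_affine.
apply: polytope_lift => a; have [_ /(_ a)] := Pp; have [_ /(_ a)] := Pq.
by nra.
Qed.

Lemma split_closure_polytope p : split_closure B p -> polytope B p.
Proof.
(* For the zero split the hull is that of the polytope, which is convex. *)
move=> /(_ (fun=> 0) Logic.I); apply: convex_hull_min => [*|q []//].
exact: polytope_convex.
Qed.

(** [g] is an integral combination [b] of the basis. Its flip inequalities hold on the disjunction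
    of [b] and, being linear in [x], on its hull. *)
Lemma split_closure_splittable p g : split_closure B p -> balanced g ->
  splittable (@lo R I) (@up R I) (period I) p.1 g.
Proof.
move=> sp bg; have Pp := split_closure_polytope sp.
have [_ bp] := Pp; have [b gE] := balanced_span bg.
apply: flip_splittable => // [|f]; first exact: period_gt0.
pose X := [set q : point R B | flip (@lo R I) (@up R I) (period I) q.1 g f].
suff : X p by [].
apply: (convex_hull_min _ _ (sp b Logic.I)) => [x y t t01 Xx Xy|q [Pq /intrP[n e]]].
  have -> : X (t *: x + (1 - t) *: y) = flip (@lo R I) (@up R I) (period I)
      (fun a => t * x.1 a + (1 - t) * y.1 a) g f.
    by congr flip; apply/funext => a; rewrite !ffunE.
  exact: flip_convex.
have [_ bq] := Pq; apply: (@flip_of_int _ _ _ _ _ _ _ _ n period_gt0 bq).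
under eq_bigr do rewrite gE.
by rewrite (tension_combination b Pq) e.
Qed.

Lemma splittable_split_closure p : polytope B p ->
  (forall g, balanced g ->
    splittable (@lo R I) (@up R I) (period I) p.1 g) -> split_closure B p.
Proof.
move=> Pp spl b _; have [_ bp] := Pp.
have S0 : (period I)%:R != 0 :> R by rewrite pnatr_eq0 -lt0n period_gt0.
have tens := tension_combination b Pp.
have [n [t [/andP[t0 t1] e]]] :=
  frac_exists (\sum_a (combination b a)%:~R * p.1 a : R) period_gt0.
have := spl _ (balanced_combination b) n t; rewrite t0 ltW // => /(_ isT e) room_t.
have [tE|t_neq0] := eqVneq t 0.
  apply: sub_gen_smallest; split=> //; apply/intrP; exists n.
  by move: e; rewrite tens tE addr0 => /(mulfI S0).
have t01 : 0 < t < 1 by rewrite t1 andbT lt_neqAle eq_sym t_neq0.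
have [x0 [x1 [b0 b1 e0 e1 pE]]] := split_points period_gt0 t01 bp e room_t.
have in_hull x m : in_box (@lo R I) (@up R I) x ->
    \sum_a (combination b a)%:~R * x a = (period I)%:R * m%:~R ->
    convex_hull [set q : point R B | polytope B q /\
      \sum_k (b k)%:~R * q.2 k \is a Num.int] (lift x).
  move=> bx ex; have Px := polytope_lift bx.
  apply: sub_gen_smallest; split=> //; apply/intrP; exists m.
  apply: (mulfI S0); rewrite -(tension_combination b Px) -ex.
  by apply: eq_bigr => a _; rewrite ffunE.
have -> : p = t *: lift x1 + (1 - t) *: lift x0.
  by rewrite -lift_affine (polytopeE Pp); congr lift; apply/funext.
apply: convex_hull_conv; first by rewrite t0 ltW.
  exact: in_hull b1 e1.
exact: in_hull b0 e0.
Qed.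

End SplitClosure.

(** Induction on the coefficient at [a0]: split off a conformal cycle with coefficient 1 there.
    Negative coefficients follow by negation. *)
Lemma splittable_from_unit (R : realType) (G : digraph) (l u : arc G -> int)
    (T : nat) (x : arc G -> R) (a0 : arc G) :
  (0 < T)%N -> in_box l u x ->
  (forall g, balanced g -> g a0 = 0 -> splittable l u T x g) ->
  (forall g, balanced g -> g a0 = 1 -> splittable l u T x g) ->
  forall g, balanced g -> splittable l u T x g.
Proof.
move=> T0 bx sp0 sp1.
have spn n g : balanced g -> g a0 = n%:Z -> splittable l u T x g.
  elim: n g => [|[|n] IH] g bg ga; [exact: sp0 | exact: sp1 |].
  have [|h [bh ha gh]] := @conformal_cycle G g a0 bg; first by rewrite ga.
  have -> : g = (fun a => h a + (g a - h a)).
    by apply/funext => a; rewrite addrC subrK.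
  apply: splittableD => //; first exact: sp1.
  apply: IH; last by rewrite ga ha; lia.
  apply/balancedP => i; rewrite excessD excessN.
  by move/balancedP: bg => ->; move/balancedP: bh => ->; rewrite subr0.
move=> g bg; have [g0|g0] := leP 0 (g a0).
  by apply: (spn `|g a0|%N) => //; lia.
have -> : g = (fun a => - - g a) by apply/funext => a; rewrite opprK.
apply: splittableN; apply: (spn `|g a0|%N); last by lia.
by apply/balancedP => i; rewrite excessN; move/balancedP: bg => ->; rewrite oppr0.
Qed.

(** * Injections that miss a single element *)

Section Embedding.
Context (A A' : finType) (h : A -> A') (c : A').
Hypothesis h_inj : injective h.
Hypothesis h_codom : forall a', (a' \in codom h) = (a' != c).

Lemma sum_codomC1 (V : nmodType) (F : A' -> V) :
  \sum_a' F a' = F c + \sum_a F (h a).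
Proof.
rewrite (bigD1 c) //=; congr (_ + _).
rewrite -(big_imset (h := h) (A := predT)) /=; last by move=> ? ? _ _; exact: h_inj.
apply: eq_bigl => a'; rewrite -h_codom; apply/idP/imsetP => [/codomP[a ->]|[a _ ->]].
  by exists a.
exact: codom_f.
Qed.

Definition extend (X : Type) (v : A -> X) (d : A' -> X) (a' : A') : X :=
  if [pick a | h a == a'] is Some a then v a else d a'.

Lemma extend_codom X (v : A -> X) d a : extend v d (h a) = v a.
Proof.
rewrite /extend; case: pickP => [b /eqP /h_inj -> //|/(_ a)].
by rewrite eqxx.
Qed.

Lemma extend_new X (v : A -> X) d : extend v d c = d c.
Proof.
rewrite /extend; case: pickP => // a /eqP e.
by have := h_codom c; rewrite -e codom_f e eqxx.
Qed.

Lemma embedP (a' : A') : a' = c \/ exists a, a' = h a.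
Proof.
have [->|] := eqVneq a' c; first by left.
by rewrite -h_codom => /codomP; right.
Qed.

End Embedding.

(** * Simple subdivision *)

Section Subdivision.
Context (R : realType) (I I' : pesp R) (s : simple_subdivision I I').
Context (B : cycle_basis I) (B' : cycle_basis I') (t : subdivided_basis s B B').

Let a0 := sub_arc s.
Let a1 := sub_a s a0.
Let a2 := sub_new_arc s.

Let a1_neq2 : a1 != a2.
Proof. by rewrite -sub_a_codom codom_f. Qed.

Let sum_arcs (V : nmodType) (F : arc I' -> V) :
  \sum_a' F a' = F a2 + \sum_a F (sub_a s a).
Proof. exact: (sum_codomC1 (@sub_a_inj _ _ _ s) (sub_a_codom s)). Qed.

Let sum_index (V : nmodType) (F : bidx B' -> V) :
  \sum_k' F k' = \sum_k F (sub_k t k).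
Proof. by apply: reindex; exact: onW_bij (sub_k_bij t). Qed.

Lemma summation_map_affine x y (r : R) :
  summation_map t (r *: x + (1 - r) *: y) =
  r *: summation_map t x + (1 - r) *: summation_map t y.
Proof.
congr (_, _); apply/ffunP => k; rewrite !ffunE //=.
by case: ifP => _; rewrite ?ffunE // /GRing.scale /=; ring.
Qed.

Lemma tension_summation_map (p : point R B') (k : bidx B) :
  \sum_a (cycle k a)%:~R * (summation_map t p).1 a =
  \sum_a' (cycle (sub_k t k) a')%:~R * p.1 a'.
Proof.
rewrite sum_arcs sub_cycle2 (bigD1 a0) // [in RHS](bigD1 a0) //=.
rewrite !ffunE eqxx sub_cycle addrA mulrDr [X in X + _ = _]addrC.
congr (_ + _); apply: eq_bigr => a /negPf na.
by rewrite ffunE -/a0 na sub_cycle.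
Qed.

Lemma polytope_summation_map p : polytope B' p -> polytope B (summation_map t p).
Proof.
move=> [cyc bp]; split=> [k|a].
  by rewrite tension_summation_map cyc ffunE (sub_period s).
rewrite ffunE; case: eqVneq => [->|na]; last by rewrite -(sub_lo na) -(sub_up na).
rewrite -(sub_lo_sum s) -(sub_up_sum s) !intrD.
by have := bp a1; have := bp a2; rewrite /a1 /a2 /a0; lra.
Qed.

(* The entry of the subdivided arc is distributed over the two halves so that
   both are at the same relative position in their bounds. *)
Definition subdivide_point (p : point R B) : point R B' :=
  let y := (lo a1)%:~R + (p.1 a0 - (lo a0)%:~R) *
    ((up a1 - lo a1)%:~R / (up a0 - lo a0)%:~R) in
  ([ffun a' => if a' == a1 then y else
      extend (sub_a s) p.1 (fun=> p.1 a0 - y) a'],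
   [ffun k' => extend (sub_k t) p.2 (fun=> 0) k']).

Let sub_k_inj : injective (sub_k t) := bij_inj (sub_k_bij t).

Lemma subdivide_pointK p : summation_map t (subdivide_point p) = p.
Proof.
case: p => x z; congr (_, _); apply/ffunP => k; rewrite !ffunE /=; last first.
  by rewrite extend_codom.
case: eqVneq => [->|nk].
  rewrite -/a0 -/a1 -/a2 eqxx eq_sym (negPf a1_neq2).
  by rewrite (extend_new (sub_a_codom s)); ring.
rewrite (inj_eq (@sub_a_inj _ _ _ s)) (negPf nk).
by rewrite (extend_codom (@sub_a_inj _ _ _ s)).
Qed.

Lemma subdivide_point_affine x y (r : R) :
  subdivide_point (r *: x + (1 - r) *: y) =
  r *: subdivide_point x + (1 - r) *: subdivide_point y.
Proof.
congr (_, _); apply/ffunP => k; rewrite !ffunE /GRing.scale /=.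
  case: ifP => _; first by rewrite /GRing.scale /=; ring.
  by rewrite /extend; case: pickP => [a _|_]; [rewrite !ffunE | ring].
by rewrite /extend; case: pickP => [a _|_]; [rewrite !ffunE | ring].
Qed.

Lemma polytope_subdivide_point p : polytope B p -> polytope B' (subdivide_point p).
Proof.
move=> [cyc bp]; split=> [k'|a'].
  have [k0 _ sk] := sub_k_bij t; rewrite -(sk k'); move: (k0 k') => k.
  rewrite -tension_summation_map subdivide_pointK cyc (sub_period s).
  by rewrite ffunE extend_codom.
have lt0 : 0 < (up a0 - lo a0)%:~R :> R by rewrite ltr0z subr_gt0 sub_lo_lt_up.
have /andP[b1 b2] := bp a0; rewrite -subr_ge0 in b1; rewrite -subr_ge0 in b2.
have /andP[_] := sub_bounds1 s; have /andP[_] := sub_bounds2 s.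
rewrite -/a0 -/a1 -/a2 -!(ler_int R) => c2 c1.
have eu := sub_up_sum s; have el := sub_lo_sum s.
move/(congr1 (fun i : int => i%:~R : R)): eu; rewrite intrD -/a0 -/a1 -/a2 => eu.
move/(congr1 (fun i : int => i%:~R : R)): el; rewrite intrD -/a0 -/a1 -/a2 => el.
move: lt0; rewrite !ffunE intrB => lt0.
(* The share of the first half in the span of the subdivided arc; [1 - th] is that of the second
   half. *)
set th := _ / _.
have th0 : 0 <= th by apply: divr_ge0; rewrite ?(ltW lt0) // intrB subr_ge0.
have eth : th * ((up a0)%:~R - (lo a0)%:~R) = (up a1)%:~R - (lo a1)%:~R.
  by rewrite divfK ?gt_eqF // intrB.
have th1 : th <= 1 by rewrite ler_pdivrMr // mul1r intrB; lra.
case: eqVneq => [->|n1]; first by apply/andP; split; nra.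
case: (embedP (sub_a_codom s) a') n1 => [-> _|[a -> na]].
  by rewrite (extend_new (sub_a_codom s)); apply/andP; split; nra.
rewrite (extend_codom (@sub_a_inj _ _ _ s)).
have {}na : a != a0 by apply: contraNneq na => ->.
by rewrite (sub_lo na) (sub_up na).
Qed.

(** The summation map and its section are affine, respect the polytopes and keep [z] up to
    reindexing, so each carries the hull of a split into that of the matching split. *)
Lemma split_closure_summation_map :
  summation_map t @` split_closure B' = split_closure B.
Proof.
apply/seteqP; split=> [_ [p sp <-] b _|p sp].
  have [k0 ks _] := sub_k_bij t.
  apply: (convex_hull_image summation_map_affine _ (sp (b \o k0) Logic.I)).
  move=> q [Pq iq]; split; first exact: polytope_summation_map.
  move: iq; rewrite sum_index; congr (_ \is a _); apply: eq_bigr => k _.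
  by rewrite ffunE /= ks.
exists (subdivide_point p); last exact: subdivide_pointK.
move=> b _.
apply: (convex_hull_image subdivide_point_affine _ (sp (b \o sub_k t) Logic.I)).
move=> q [Pq iq]; split; first exact: polytope_subdivide_point.
move: iq; rewrite sum_index; congr (_ \is a _); apply: eq_bigr => k _.
by rewrite ffunE extend_codom.
Qed.

End Subdivision.

(** * Simple free augmentation *)

Section Augmentation.
Context (R : realType) (I I' : pesp R) (s : simple_free_augmentation I I').
Context (B : cycle_basis I) (B' : cycle_basis I') (t : augmented_basis s B B').

Let c := aug_arc s.
Let a_inj := @aug_a_inj _ _ _ s.

Let sum_arcs (V : nmodType) (F : arc I' -> V) :
  \sum_a' F a' = F c + \sum_a F (aug_a s a).
Proof. exact: (sum_codomC1 a_inj (aug_a_codom s)). Qed.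

Lemma natural_projection_affine x y (r : R) :
  natural_projection t (r *: x + (1 - r) *: y) =
  r *: natural_projection t x + (1 - r) *: natural_projection t y.
Proof. by congr (_, _); apply/ffunP => k; rewrite !ffunE. Qed.

Lemma tension_aug_cycle (x : arc I' -> R) (k : bidx B) :
  \sum_a' (cycle (aug_k t k) a')%:~R * x a' =
  \sum_a (cycle k a)%:~R * x (aug_a s a).
Proof.
rewrite sum_arcs aug_cycle0 mul0r add0r.
by apply: eq_bigr => a _; rewrite aug_cycle.
Qed.

Lemma polytope_natural_projection p :
  polytope B' p -> polytope B (natural_projection t p).
Proof.
move=> [cyc bp]; split=> [k|a]; last by rewrite ffunE -(aug_lo s) -(aug_up s).
rewrite ffunE -(aug_period s) -cyc tension_aug_cycle.
by apply: eq_bigr => a _; rewrite ffunE.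
Qed.

Lemma natural_projection_sub :
  natural_projection t @` split_closure B' `<=` split_closure B.
Proof.
(* [b'] is [b] extended by 0 outside the range of [aug_k]. *)
move=> _ [p sp <-] b _; pose b' k' := \sum_(k | aug_k t k == k') b k.
apply: (convex_hull_image natural_projection_affine _ (sp b' Logic.I)).
move=> q [Pq iq]; split; first exact: polytope_natural_projection.
move: iq; congr (_ \is a _); rewrite /b'.
under eq_bigr do rewrite rmorph_sum /= mulr_suml.
rewrite (exchange_big_dep predT) //=; apply: eq_bigr => k _.
by rewrite (big_pred1 (aug_k t k)) ?ffunE // => k'; rewrite /= eq_sym.
Qed.

Lemma balanced_aug (g : arc I' -> int) : balanced g -> g c = 0 ->
  balanced (fun a => g (aug_a s a)).
Proof.
move=> /balancedP bg gc; apply/balancedP => i; rewrite -[RHS](bg (aug_v s i)).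
rewrite /excess sum_arcs gc mul0r add0r; apply: eq_bigr => a _.
by rewrite aug_tail aug_head !(inj_eq (@aug_v_inj _ _ _ s)).
Qed.

Lemma splittable_aug (g : arc I' -> int) (x : arc I' -> R) : g c = 0 ->
  splittable (@lo R I) (@up R I) (period I) (fun a => x (aug_a s a))
    (fun a => g (aug_a s a)) ->
  splittable (@lo R I') (@up R I') (period I') x g.
Proof.
move=> gc sg n r r01; rewrite sum_arcs gc mul0r add0r (aug_period s) => e.
apply: (le_trans (sg n r r01 e)).
rewrite /room sum_arcs gc oppr0 pos_id // !mul0r !add0r.
by apply: ler_sum => a _; rewrite /cap (aug_lo s) (aug_up s).
Qed.

Lemma split_closure_sub_natural_projection :
  split_closure B `<=` natural_projection t @` split_closure B'.
Proof.
move=> p sp; have Pp := split_closure_polytope sp; have [_ bp] := Pp.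
have T0 := period_gt0 I'; have S1 : 1 <= (period I')%:R :> R by rewrite ler1n.
(* The new arc starts at its lower bound, so the shift [y] found below is its slack. *)
pose x := extend (aug_a s) p.1 (fun a' => (lo a')%:~R).
have xa a : x (aug_a s a) = p.1 a by exact: extend_codom.
have xc : x c = (lo c)%:~R by exact: (extend_new (aug_a_codom s)).
have free := aug_free s.
have eup : (up c)%:~R = (lo c)%:~R + (period I')%:R - 1 :> R.
  have -> : up c = lo c + (period I')%:Z - 1 by rewrite /c; lia.
  by rewrite !intrD mulrNz -pmulrn mulr1z.
have bx : in_box (@lo R I') (@up R I') x.
  move=> a'; have [->|[a ->]] := embedP (aug_a_codom s) a'.
    by rewrite xc eup; lra.
  by rewrite xa (aug_lo s) (aug_up s).
have spl0 (y : arc I' -> R) (g : arc I' -> int) :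
    (forall a, y (aug_a s a) = p.1 a) -> balanced g -> g c = 0 ->
    splittable (@lo R I') (@up R I') (period I') y g.
  move=> yE bg gc; apply: splittable_aug => //.
  have -> : (fun a => y (aug_a s a)) = p.1 by exact/funext.
  exact/(split_closure_splittable sp)/balanced_aug.
have subB (g h : arc I' -> int) :
    balanced g -> balanced h -> balanced (fun a => g a - h a).
  move=> /balancedP bg /balancedP bh; apply/balancedP => i.
  by rewrite excessD excessN bg bh subr0.
have [y [y01 sply]] := exists_shift subB bx xc free T0 (fun g => spl0 x g xa).
have ya a : shift x c y (aug_a s a) = p.1 a.
  have : aug_a s a != c by rewrite -aug_a_codom codom_f.
  by rewrite /shift => /negPf ->; rewrite mul0r addr0.
have box_shift : in_box (@lo R I') (@up R I') (shift x c y).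
  move=> a'; have [->|[a ->]] := embedP (aug_a_codom s) a'.
    by rewrite /shift eqxx mul1r xc eup; lra.
  by rewrite ya (aug_lo s) (aug_up s).
exists (lift B' (shift x c y)).
  apply: splittable_split_closure; first exact: polytope_lift.
  have -> : (lift B' (shift x c y)).1 = shift x c y :> (arc I' -> R).
    by apply/funext => a; rewrite ffunE.
  by apply: (splittable_from_unit (a0 := c)) => // g; apply: spl0.
rewrite [RHS](polytopeE Pp); congr (_, _); apply/ffunP => k; rewrite !ffunE //.
by rewrite tension_aug_cycle (aug_period s); under eq_bigr do rewrite ya.
Qed.

Lemma split_closure_natural_projection :
  natural_projection t @` split_closure B' = split_closure B.
Proof.
apply/seteqP; split; first exact: natural_projection_sub.
exact: split_closure_sub_natural_projection.
Qed.

End Augmentation.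

(** * Composition along the sequence of operations *)

Theorem theorem5p15 (R : realType) (I I' : pesp R)
    (B : cycle_basis I) (B' : cycle_basis I') (e : expansion B B') :
  composite_map e @` split_closure B' = split_closure B.
Proof.
elim: e => [|I1 I2 B1 B2 e IH s t|I1 I2 B1 B2 e IH s t] /=.
- by rewrite image_id.
- by rewrite -image_comp split_closure_summation_map IH.
- by rewrite -image_comp split_closure_natural_projection IH.
Qed.
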